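(* Totally unimodular graphs are ESP.
   Context: All graphs are finite and simple. Totally unimodular graphs. A matrix is totally unimodular if every square submatrix has determinant $0$ or $\pm1$. For a graph $G$, $B_G$ is the $\{0,1\}$ incidence matrix with rows indexed by the (inclusionwise) maximal cliques of $G$ and columns indexed by the vertices of $G$. $G$ is totally unimodular if $B_G$ is totally unimodular. ESP graphs. For a multiset $\Lambda$ of cliques of $G$ and $v\in V(G)$, $d_\Lambda(v)$ denotes the number of members of $\Lambda$ (with multiplicity) that contain $v$. A graph $G=(V,E)$ is equitably subpartitionable (ESP) if for every set $\Lambda$ of maximal cliques of $G$ there exist two multisets $\Lambda_1,\Lambda_2$ of cliques of $G$ (not necessarily members of $\Lambda$) such that (i) $|\Lambda_1|+|\Lambda_2|\le|\Lambda|$; (ii) $d_{\Lambda_1}(v)+d_{\Lambda_2}(v)\ge d_\Lambda(v)$ for all $v\in V$; (iii) $\min\{d_{\Lambda_1}(v),d_{\Lambda_2}(v)\}\ge\lfloor d_\Lambda(v)/2\rfloor$ for all $v\in V$. *)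

(* Defs.v *)
From mathcomp Require Import all_boot all_order all_algebra.
From mathcomp Require Import finmap multiset.

Set Implicit Arguments.
Unset Strict Implicit.
Unset Printing Implicit Defensive.

Local Open Scope mset_scope.
Local Open Scope nat_scope.

(* A finite simple graph is a symmetric irreflexive e : rel V, V : finType;
   the definitions below do not carry these two hypotheses themselves. *)

Definition clique (V : finType) (e : rel V) (K : {set V}) : bool :=
  [forall x in K, forall y in K, (x != y) ==> e x y].

Definition maxcliques (V : finType) (e : rel V) : {set {set V}} :=
  [set K | maxset (clique e) K].

(* The rows (maximal cliques) and columns (vertices) of the incidence matrix
   carry no intrinsic order; they are numbered by enum_val. *)
Definition clique_incidence (V : finType) (e : rel V) :
    'M[int]_(#|maxcliques e|, #|V|) :=
  (\matrix_(i, j) (enum_val j \in (enum_val i : {set V}))%:R)%R.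

(* A k x k submatrix is given by injective row and column selections; these
   need not be increasing, which affects the determinant only up to sign. *)
Definition totally_unimodular (m n : nat) (A : 'M[int]_(m, n)) : Prop :=
  forall (k : nat) (f : 'I_k -> 'I_m) (g : 'I_k -> 'I_n),
    injective f -> injective g ->
    (\det (mxsub f g A) \in [:: 0; 1; -1])%R.

Definition totally_unimodular_graph (V : finType) (e : rel V) : Prop :=
  totally_unimodular (clique_incidence e).

(* The sequence underlying a multiset repeats each element according to its
   multiplicity, so count (and size below) take multiplicities into account. *)
Definition clique_degree (V : finType) (L : {mset {set V}}) (v : V) : nat :=
  count (fun K : {set V} => v \in K) L.

Definition mset_of_set (T : finType) (A : {set T}) : {mset T} :=
  seq_mset (enum A).

Definition equitably_subpartitionable (V : finType) (e : rel V) : Prop :=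
  forall L : {set {set V}}, L \subset maxcliques e ->
  exists L1 L2 : {mset {set V}},
    [/\ {in L1, forall K, clique e K} /\ {in L2, forall K, clique e K},
        size L1 + size L2 <= #|L|,
        forall v, clique_degree (mset_of_set L) v
                  <= clique_degree L1 v + clique_degree L2 v
      & forall v, (clique_degree (mset_of_set L) v)./2
                  <= minn (clique_degree L1 v) (clique_degree L2 v)].

(* Main.v *)
Require Import Defs.
From mathcomp Require Import all_boot all_order all_algebra.
From mathcomp Require Import finmap multiset.
From mathcomp Require Import zify lra.

Import Order.TTheory GRing.Theory Num.Theory.

(** The idea is to split the given set [L] of maximal cliques into two parts
    that every vertex sees almost equally often.  Such a split is a 0/1 vector on the rows in [L] whose product with
    the incidence matrix is, in each column [v], the degree of [v] halved and
    rounded up or down.  With all weights equal to 1/2 this holds exactly but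
    fractionally, so it remains to round a fractional vector to an integral one
    while rounding each of its column sums as well ([tu_rounding]).

    For that, call a coordinate of [x] or of [x A] frozen when it is an
    integer.  If some coordinate of [x] is not frozen, there is a nonzero
    direction [y] that moves no frozen coordinate ([tu_free_direction]):
    otherwise the rows that are not frozen, restricted to the frozen columns,
    would be linearly independent, hence contain a nonsingular square submatrix
    [W]; by total unimodularity det [W] is 1 or -1, so [W] has an integral
    inverse, and the free part of [x], which [W] maps to an integral vector,
    would be integral.  Moving along [y] until a coordinate first reaches an
    integer ([step_to_integer]) crosses no integer bound and increases the
    number of frozen coordinates, so the process stops at an integral vector.
    Applied to weights 1/2 on a set of rows this gives the theorem of
    Ghouila-Houri on equitable row bicolourings ([ghouila_houri]). *)

(** For an integer [b] this says that [b] is the floor or the ceiling of [a].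
    Phrasing it through integer bounds makes sense at the fractional
    intermediate stages as well, and makes the relation transitive. *)
Definition rounds (a b : rat) : Prop :=
  forall q : int, ((a <= q%:~R)%R -> (b <= q%:~R)%R) /\
                  ((q%:~R <= a)%R -> (q%:~R <= b)%R).

Section Rounding.
Local Open Scope ring_scope.

Lemma rounds_trans b a c : rounds a b -> rounds b c -> rounds a c.
Proof.
move=> ab bc q; have [ab1 ab2] := ab q; have [bc1 bc2] := bc q.
by split=> [/ab1/bc1|/ab2/bc2].
Qed.

(** The values [a k] travel at speeds [b k], up to the first time at which one
    of the moving values meets the next integer on its way: since that is the
    first such event, no value has passed an integer. *)
Lemma step_to_integer {I : finType} (a b : I -> rat) (k0 : I) :
    (forall k, a k \is a Num.int -> b k = 0) -> b k0 != 0 ->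
  exists t : rat,
    (forall k, rounds (a k) (a k + t * b k)) /\
    exists2 k, a k \isn't a Num.int & a k + t * b k \is a Num.int.
Proof.
move=> ab0 bk0.
(* [hit k] is the integer towards which [a k] moves, [t k] the arrival time. *)
pose hit k : rat :=
  (if 0 < b k then Num.ceil (a k) else Num.floor (a k))%:~R.
pose t k := (hit k - a k) / b k.
case: (@arg_minP _ _ _ k0 (fun k => b k != 0) t bk0) => k1 bk1 t_min.
exists (t k1); split; last first.
  exists k1; first by apply: contraNN bk1 => /ab0 ->.
  by rewrite /t divfK // addrC subrK; apply: intr_int.
have t_ge0 : 0 <= t k1.
  rewrite /t /hit; case: ltrgt0P bk1 => // bk1 _.
    by apply: divr_ge0; [rewrite subr_ge0 ceil_ge | exact: ltW].
  by apply: mulr_le0; [rewrite subr_le0 floor_le | rewrite invr_le0 ltW].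
move=> k; have [->|bk] := eqVneq (b k) 0; first by rewrite mulr0 addr0.
have := t_min k bk; rewrite /(t k) /hit.
case: ltrgt0P bk => // bk _ le_t q.
  move: le_t; rewrite ler_pdivlMr // => le_t; have tb := mulr_ge0 t_ge0 (ltW bk).
  split=> aq; last by lra.
  have : (Num.ceil (a k))%:~R <= q%:~R :> rat by rewrite ler_int ceil_le_int.
  by lra.
move: le_t; rewrite ler_ndivlMr // => le_t; have tb := mulr_ge0_le0 t_ge0 (ltW bk).
split=> aq; first by lra.
have : q%:~R <= (Num.floor (a k))%:~R :> rat by rewrite ler_int floor_ge_int.
by lra.
Qed.

(** By Cramer's rule, the inverse of a unimodular integer matrix is integral. *)
Lemma row_unimodular_int n (W : 'M[int]_n) (x : 'rV[rat]_n) :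
    W \in unitmx -> x *m map_mx intr W \is a mxOver Num.int ->
  x \is a mxOver Num.int.
Proof.
move=> unitW xW.
rewrite -[x]mulmx1 -(map_mx1 intr) -(mulmxV unitW) map_mxM mulmxA.
apply: mxOverM xW _; apply/mxOverP => i j; rewrite mxE; exact: intr_int.
Qed.

(** Total unimodularity enters here.  Geometrically: a point of the polyhedron
    cut out by integral bounds on [x] and [x A] that is not integral is not a
    vertex, and [y] is a direction inside the face that contains it. *)
Lemma tu_free_direction {m n} (A : 'M[int]_(m, n)) (x : 'rV[rat]_m) i0 :
    totally_unimodular A -> x 0 i0 \isn't a Num.int ->
  exists2 y : 'rV[rat]_m, y != 0 &
    (forall i, x 0 i \is a Num.int -> y 0 i = 0) /\
    (forall j, (x *m map_mx intr A) 0 j \is a Num.int ->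
               (y *m map_mx intr A) 0 j = 0).
Proof.
move=> tuA xi0; set B := map_mx intr A.
pose F := [set i | x 0 i \isn't a Num.int].
pose J := [set j | (x *m B) 0 j \is a Num.int].
have Fi0 : i0 \in F by rewrite inE.
pose N : 'M[rat]_(#|F|, #|J|) := mxsub enum_val enum_val B.
have [freeN|] := boolP (row_free N); last first.
  rewrite -kermx_eq0 => /rowV0Pn[u /sub_kermxP uN u0].
  (* A left kernel vector of [N], extended by zero to the frozen rows. *)
  exists (\row_i \sum_(k | enum_val k == i) u 0 k).
    apply: contraNneq u0 => y0; apply/eqP/rowP => k; rewrite mxE.
    have := congr1 (fun z : 'rV__ => z 0 (enum_val k)) y0; rewrite !mxE.
    by rewrite (big_pred1 k) // => l; rewrite /= (inj_eq enum_val_inj).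
  split=> [i xi|j xj].
    rewrite mxE big1 // => k /eqP ki; have := enum_valP k.
    by rewrite ki inE xi.
  have Jj : j \in J by rewrite inE.
  have := congr1 (fun z : 'rV__ => z 0 (enum_rank_in Jj j)) uN.
  rewrite [RHS]mxE => uNj; rewrite -[RHS]uNj !mxE.
  under eq_bigr do rewrite [X in (X * _)%R]mxE mulr_suml /=.
  rewrite (exchange_big_dep predT) //=; apply: eq_bigr => k _.
  by rewrite (big_pred1 (enum_val k)) ?mxE ?enum_rankK_in // => i; rewrite /= eq_sym.
have fullNT : row_full N^T by rewrite /row_full mxrank_tr -/(row_free N).
pose f := fullrankfun fullNT.
pose W : 'M[int]_#|F| := mxsub enum_val (enum_val \o f) A.
have WE : map_mx intr W = (rowsub f N^T)^T by apply/matrixP=> i j; rewrite !mxE.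
have unitW : W \in unitmx.
  have : map_mx (intr : int -> rat) W \in unitmx.
    by rewrite WE unitmx_tr fullrowsub_unit.
  have inj : injective (enum_val \o f).
    by move=> ? ? /enum_val_inj /fullrankfun_inj.
  have := tuA _ _ _ (@enum_val_inj _ (mem F)) inj.
  rewrite !unitmxE det_map_mx -/W !inE.
  by case/or3P=> /eqP ->.
(* In a frozen column, the contribution of the frozen rows is an integer, hence
   so is that of the rows in [F]. *)
have : (\row_(k < #|F|) x 0 (@enum_val _ (mem F) k)) \is a mxOver Num.int.
  apply: (row_unimodular_int _ _ _ unitW).
  apply/mxOverP => i j; rewrite ord1 {i} !mxE.
  have := enum_valP (f j); rewrite inE mxE (bigID (mem F)) /=.
  rewrite rpredDr; last first.
    apply: rpred_sum => i; rewrite inE negbK => xi.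
    by rewrite rpredM // mxE intr_int.
  rewrite big_enum_val; congr (is_true (_ \is a Num.int)).
  by apply: eq_bigr => k _; rewrite !mxE.
move/mxOverP/(_ 0 (enum_rank_in Fi0 i0)).
by rewrite mxE enum_rankK_in // (negPf xi0).
Qed.

(** Simultaneous rounding of a vector and of its image: an integrality theorem
    of Hoffman and Kruskal, by induction on the number of coordinates that are
    not integers. *)
Lemma tu_rounding {m n} (A : 'M[int]_(m, n)) (x : 'rV[rat]_m) :
    totally_unimodular A ->
  exists z : 'rV[int]_m,
    (forall i, rounds (x 0 i) (z 0 i)%:~R) /\
    (forall j, rounds ((x *m map_mx intr A) 0 j) ((z *m A) 0 j)%:~R).
Proof.
move=> tuA; set B := map_mx intr A.
(* Gathers the coordinates of [x] and of [x A] into the single vector [x M]. *)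
pose M : 'M[rat]_(m, m + n) := row_mx 1%:M B.
have ME (y : 'rV_m) : y *m M = row_mx y (y *m B) by rewrite mul_mx_row mulmx1.
have [z [zM xz]] : exists z : 'rV[rat]_m,
    z \is a mxOver Num.int /\ forall k, rounds ((x *m M) 0 k) ((z *m M) 0 k).
  pose fracs (y : 'rV[rat]_m) := [set k | (y *m M) 0 k \isn't a Num.int].
  have [N] := ubnP #|fracs x|; elim: N x => // N IHN x; rewrite ltnS => leN.
  have [i0 xi0|x_int] := pickP (fun i => x 0 i \isn't a Num.int); last first.
    exists x; split=> //; apply/mxOverP => i j.
    by rewrite ord1 -[_ \is a _]negbK (x_int j).
  have [y y0 [yx yB]] := tu_free_direction _ _ _ tuA xi0.
  have [k0 yk0] : exists k, (y *m M) 0 k != 0.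
    have /rV0Pn[k yk] := y0; exists (lshift n k).
    by rewrite ME row_mxEl.
  have yM k : (x *m M) 0 k \is a Num.int -> (y *m M) 0 k = 0.
    rewrite !ME -(splitK k); case: (split k) => k' /=.
      by rewrite !row_mxEl => /yx.
    by rewrite !row_mxEr => /yB.
  have [t [xt [k1 xk1 xtk1]]] := step_to_integer _ _ _ yM yk0.
  have xtE k : ((x + t *: y) *m M) 0 k = (x *m M) 0 k + t * (y *m M) 0 k.
    by rewrite mulmxDl -scalemxAl mxE [X in _ + X]mxE.
  have [|z [zM xz]] := IHN (x + t *: y).
    apply: leq_trans leN; apply: proper_card; apply/properP; split.
      apply/subsetP => k; rewrite !inE xtE; apply: contraNN => xk.
      by rewrite yM // mulr0 addr0.
    by exists k1; rewrite !inE // negbK xtE.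
  exists z; split=> // k; apply: rounds_trans (xz k); rewrite xtE; exact: xt.
have zE i : (Num.floor (z 0 i))%:~R = z 0 i.
  by rewrite floorK //; apply: (mxOverP zM).
exists (map_mx Num.floor z); split=> [i|j].
  by have := xz (lshift n i); rewrite !ME !row_mxEl mxE zE.
have := xz (rshift m j); rewrite !ME !row_mxEr.
congr (rounds _ _); rewrite !mxE rmorph_sum.
by apply: eq_bigr => i _; rewrite !mxE rmorphM /= zE.
Qed.

(** Rounding the weights 1/2 on [R] and 0 elsewhere can only give weights 0 and
    1, with 1 only inside [R]: the weights are the indicator of a subset. *)
Lemma ghouila_houri {m n} (A : 'M[int]_(m, n)) (R : {set 'I_m}) :
    totally_unimodular A ->
  exists2 S : {set 'I_m}, S \subset R &
    forall j, rounds (2^-1 * (\sum_(i in R) A i j)%:~R)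
                     (\sum_(i in S) A i j)%:~R.
Proof.
move=> tuA; pose x : 'rV[rat]_m := \row_i (2^-1 * (i \in R)%:R).
have [z [xz xzA]] := tu_rounding A x tuA.
pose S := [set i | z 0 i == 1]; exists S.
  apply/subsetP => i; rewrite inE => /eqP zi; have [hi _] := xz i 0.
  by move: hi; rewrite zi mxE; case: (i \in R) => //= /(_ ltac:(lra)).
have zE i : z 0 i = (i \in S)%:R.
  have [_ lo] := xz i 0; have [hi _] := xz i 1.
  rewrite inE; move: lo hi; rewrite mxE !ler_int.
  have Ri : 0 <= ((i \in R)%:R : rat) <= 1 by case: (i \in R).
  move=> /(_ ltac:(lra)) lo /(_ ltac:(lra)) hi.
  by case: eqP => /=; lia.
move=> j; have := xzA j; congr (rounds _ _%:~R); rewrite mxE.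
  rewrite rmorph_sum big_distrr [RHS]big_mkcond /=; apply: eq_bigr => i _.
  by rewrite !mxE; case: (i \in R); rewrite ?mulr1 ?mulr0 ?mul0r.
rewrite [RHS]big_mkcond; apply: eq_bigr => i _.
by rewrite zE; case: (i \in S); rewrite ?mul1r ?mul0r.
Qed.

Lemma rounds_half (d k : nat) :
  rounds (2^-1 * d%:R) k%:R -> (d./2 <= k <= uphalf d)%N.
Proof.
move=> r; have [_ lo] := r (d./2 : int); have [hi _] := r (uphalf d : int).
move: lo hi; rewrite uphalf_half -!pmulrn !ler_nat.
rewrite -[in d%:R](odd_double_half d) -muln2 !natrD natrM.
have o : 0 <= (odd d)%:R :> rat by rewrite ler0n.
by move=> /(_ ltac:(lra)) -> /(_ ltac:(lra)) ->.
Qed.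

End Rounding.

Lemma mem_mset_of_set (T : finType) (A : {set T}) x :
  (x \in mset_of_set A) = (x \in A).
Proof. by rewrite (perm_mem (perm_eq_seq_mset _)) mem_enum. Qed.

Lemma size_mset_of_set (T : finType) (A : {set T}) :
  size (mset_of_set A) = #|A|.
Proof. by rewrite (perm_size (perm_eq_seq_mset _)) -cardE. Qed.

(** The form in which degrees split additively along a partition of the
    cliques. *)
Lemma clique_degree_set (V : finType) (A : {set {set V}}) v :
  clique_degree (mset_of_set A) v = \sum_(K in A) (v \in K).
Proof.
rewrite /clique_degree (permP (perm_eq_seq_mset _)) -sum1_count big_enum_cond.
by rewrite big_mkcondr; apply: eq_bigr => K _; case: (v \in K).
Qed.

Lemma clique_incidence_sum (V : finType) (e : rel V)
    (S : {set 'I_#|maxcliques e|}) v :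
  (\sum_(i in S) clique_incidence e i (enum_rank v) =
   (clique_degree (mset_of_set [set enum_val i | i in S]) v)%:R)%R.
Proof.
rewrite clique_degree_set big_imset; last by move=> i j _ _ /enum_val_inj.
by rewrite natr_sum; apply: eq_bigr => i _; rewrite mxE enum_rankK.
Qed.

Theorem theorem4p1 (V : finType) (e : rel V)
    (e_sym : symmetric e) (e_irr : irreflexive e) :
  totally_unimodular_graph e -> equitably_subpartitionable e.
Proof.
move=> tuG L LM.
pose row (i : 'I_#|maxcliques e|) : {set V} := enum_val i.
pose R := row @^-1: L.
have LE : row @: R = L.
  apply/setP => K; apply/imsetP/idP => [[i] | LK]; first by rewrite inE => ? ->.
  have MK := subsetP LM K LK.
  by exists (enum_rank_in MK K); rewrite ?inE /row enum_rankK_in.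
have [S SR halves] := ghouila_houri _ R tuG.
pose L1 := row @: S; pose L2 := L :\: L1.
have L1L : L1 \subset L by rewrite -LE imsetS.
have degD v : clique_degree (mset_of_set L) v =
    clique_degree (mset_of_set L1) v + clique_degree (mset_of_set L2) v.
  by rewrite !clique_degree_set (big_setID L1) /= (setIidPr L1L).
have deg1 v : (clique_degree (mset_of_set L) v)./2
      <= clique_degree (mset_of_set L1) v
      <= uphalf (clique_degree (mset_of_set L) v).
  have := halves (enum_rank v).
  by rewrite !clique_incidence_sum -/row LE !rmorph_nat => /rounds_half.
have cliqueL K : K \in L -> clique e K.
  by move=> /(subsetP LM); rewrite inE => /maxsetp.
exists (mset_of_set L1), (mset_of_set L2); split.
- split=> K; rewrite mem_mset_of_set; first by move/(subsetP L1L)/cliqueL.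
  by case/setDP => /cliqueL.
- by rewrite !size_mset_of_set -(cardsID L1 L) (setIidPr L1L).
- by move=> v; rewrite degD.
- by move=> v; have := deg1 v; have := degD v; lia.
Qed.
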